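(* Let $G=(V,E)$ be a finite connected graph with $m=|E|$, equipped with a weighted random walk $\mathbf{P}$ and a corresponding weighted deterministic walk with rotor sequence lengths $\tilde d(u)$. Then for every vertex $v\in V$, \[ K(v)\le \max_{u\in V}\mathsf{H}(u,v)+\frac{\tilde\kappa\, c_{\max}}{\pi_v}\,\Psi(\mathbf{P},v)+2m\,\tilde\kappa\, c_{\max}. \]
   Context: Weighted random walk: symmetric weights $c(u,v)=c(v,u)\in\mathbb{N}_0$, positive exactly when $\{u,v\}\in E$; $c(u)=\sum_{w}c(u,w)$, $\mathbf{P}_{u,v}=c(u,v)/c(u)$, $c_{\max}=\max_{u,v}c(u,v)$, stationary distribution $\pi_u=c(u)/\sum_w c(w)$, hitting time $\mathsf{H}(u,v)$ = expected first time $t\ge0$ at which the walk started at $u$ is at $v$. A corresponding weighted deterministic walk assigns each vertex $u$ a rotor sequence $(\tilde s(u,1),\dots,\tilde s(u,\tilde d(u)))\in V^{\tilde d(u)}$ in which, for each $v$, the proportion of indices $i$ with $\tilde s(u,i)=v$ equals $\mathbf{P}_{u,v}$; $\tilde\kappa:=\max_{u\in V}\tilde d(u)/\deg(u)$. Define \[ K(v):=\max_{u\in V}\mathsf{H}(u,v)+\frac12\Big(\frac{\tilde d(v)}{\pi_v}+\sum_{i,j\in V}\tilde d(i)\,\mathbf{P}_{i,j}\,\big|\mathsf{H}(i,v)-\mathsf{H}(j,v)-1\big|\Big). \] The local divergence with respect to $v$ is $\Psi(\mathbf{P},v):=\sum_{t=0}^\infty\sum_{\{i,j\}\in E}\big|\mathbf{P}^t_{i,v}-\mathbf{P}^t_{j,v}\big|$.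 *)

(* Defs.v *)
From HB Require Import structures.
From mathcomp Require Import all_boot all_order all_algebra.
From mathcomp Require Import all_classical all_reals all_analysis.

Set Implicit Arguments.
Unset Strict Implicit.
Unset Printing Implicit Defensive.

Import Order.TTheory GRing.Theory Num.Theory.
Local Open Scope ring_scope.

(* A graph on V is its edge set E, an edge being the set [set u; v] of its
   endpoints.  Loops [set u] are allowed and count once in #|E| and in deg;
   simple graphs are the case where every edge has cardinality 2. *)
Definition is_edge_set (V : finType) (E : {set {set V}}) : Prop :=
  forall A : {set V}, A \in E -> (1 <= #|A| <= 2)%N.

Definition adj (V : finType) (E : {set {set V}}) : rel V :=
  fun u v => [set u; v] \in E.

Definition connected_graph (V : finType) (E : {set {set V}}) : Prop :=
  forall u v : V, connect (adj E) u v.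

Definition deg (V : finType) (E : {set {set V}}) (u : V) : nat :=
  #|[set A in E | u \in A]|.

Definition is_weight (V : finType) (E : {set {set V}}) (c : V -> V -> nat) :
    Prop :=
  (forall u v : V, c u v = c v u) /\ (forall u v : V, (0 < c u v)%N = adj E u v).

Definition cvertex (V : finType) (c : V -> V -> nat) (u : V) : nat :=
  (\sum_(w : V) c u w)%N.

Definition cmax (V : finType) (c : V -> V -> nat) : nat :=
  (\max_(u : V) \max_(v : V) c u v)%N.

Section Walk.
Variables (R : realType) (V : finType).
Implicit Types (E : {set {set V}}) (c : V -> V -> nat) (d : V -> nat).

Definition trans c (u v : V) : R := (c u v)%:R / (cvertex c u)%:R.

(* Matrices are indexed by ordinals, hence the enumeration of V. *)
Definition transX c (t : nat) (u v : V) : R :=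
  ((\matrix_(a < #|V|, b < #|V|) trans c (enum_val a) (enum_val b)) ^+ t)
    (enum_rank u) (enum_rank v).

Definition stationary c (u : V) : R :=
  (cvertex c u)%:R / (\sum_(w : V) cvertex c w)%N%:R.

(* Probability that the walk X_0 = u, X_1, ..., X_t first visits v at time t:
   w ranges over the trajectories (X_1, ..., X_t), each weighted by the product
   of its transition probabilities. *)
Definition first_visit_pr c (u v : V) (t : nat) : R :=
  \sum_(w : t.-tuple V | index v (u :: w) == t)
     \prod_(p <- zip (u :: w) w) trans c p.1 p.2.

(* Expectation of the [0, +oo]-valued first visit time; the last summand
   accounts for the event that v is never visited (with +oo * 0 = 0). *)
Definition hitting c (u v : V) : \bar R :=
  (\sum_(0 <= t <oo) (t%:R * first_visit_pr c u v t)%:E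
   + +oo * (1 - \sum_(0 <= t <oo) (first_visit_pr c u v t)%:E))%E.

Definition max_hitting c (v : V) : \bar R :=
  \big[Order.max/-oo%E]_(u : V) hitting c u v.

Definition is_rotor c d (s : forall u : V, (d u).-tuple V) : Prop :=
  forall u : V, (0 < d u)%N /\
    forall v : V, (count_mem v (s u))%:R / (d u)%:R = trans c u v.

Definition kappa E d : R :=
  \big[Num.max/0]_(u : V) ((d u)%:R / (deg E u)%:R).

Definition Kconst c d (v : V) : \bar R :=
  (max_hitting c v +
   (2^-1)%:E * (((d v)%:R / stationary c v)%:E +
     \sum_(i : V) \sum_(j : V)
        ((d i)%:R * trans c i j)%:E * `|hitting c i v - hitting c j v - 1|))%E.

(* |f i - f j| as a function of the unordered edge A = [set i; j]. *)
Definition edge_diff (f : V -> R) (A : {set V}) : R :=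
  (\sum_(i in A) \sum_(j in A) `|f i - f j|) / 2.

Lemma edge_diffE (f : V -> R) (i j : V) :
  edge_diff f [set i; j] = `|f i - f j|.
Proof.
rewrite /edge_diff; case: (eqVneq i j) => [->|ij].
  by rewrite finset.setUid !big_set1 subrr normr0 mul0r.
rewrite !big_setU1 ?inE //= !big_set1 !big_setU1 ?inE //= !big_set1.
by rewrite !subrr !normr0 addr0 add0r (distrC (f j)) mulrDl -splitr.
Qed.

(* Extended-real valued: the series diverges for instance when the walk is
   periodic. *)
Definition local_divergence E c (v : V) : \bar R :=
  (\sum_(0 <= t <oo)
     (\sum_(A in E) edge_diff (fun i => transX c t i v) A)%:E)%E.

End Walk.

(* Main.v *)
(** Write [x_t(u)] for the probability that the walk from [u] is at [v] at time
    [t].  If the local divergence is infinite, so is the right-hand side.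
    Otherwise the series [D(u) = sum_t (x_t(u) - x_t(v))] converges, first for
    the difference along an edge and then, by connectedness, everywhere; it
    satisfies [P D - D = pi_v - 1_v], so [- D / pi_v] solves the one-step
    equations of the hitting times of [v] and therefore equals them.  Hence
    [pi_v * |H(i, v) - H(j, v)| <= sum_t |x_t(i) - x_t(j)|], which is summed
    over the edges.  The rest is [d(i) P_ij <= kappa * c_max] on ordered adjacent
    pairs, of which there are at most [2m]. *)

Require Import Defs.
From mathcomp Require Import all_boot all_order all_algebra.
From mathcomp Require Import all_classical all_reals all_analysis.
From mathcomp Require Import zify ring lra.

Import Order.TTheory GRing.Theory Num.Theory.
Import numFieldNormedType.Exports.
Local Open Scope ring_scope.

(** * Degrees and sums over adjacent pairs, loops included *)

Section GraphCounting.
Context (V : finType) (E : {set {set V}}).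
Hypothesis hE : is_edge_set E.

Lemma set2_inj (u : V) : injective (fun v : V => [set u; v]).
Proof.
move=> v w /= e.
have /set2P[vu|//] : v \in [set u; w] by rewrite -e set22.
have /set2P[wu|//] : w \in [set u; v] by rewrite e set22.
by rewrite vu wu.
Qed.

(** The map [w => [set u; w]] matches the neighbours of [u] with the edges through [u]; a loop comes
    from [w = u]. *)
Lemma deg_adj u : deg E u = #|[set v | adj E u v]|.
Proof.
rewrite /deg -(card_imset _ (@set2_inj u)); apply: eq_card => A.
rewrite inE; apply/andP/imsetP => [[AE uA]|[v]]; last first.
  by rewrite inE => uv ->; split=> //; rewrite set21.
have [/eqP/cards1P[x eA]|A1] := eqVneq #|A| 1%N.
  move: uA AE; rewrite eA inE => /eqP -> AE.
  by exists x; rewrite ?inE /adj finset.setUid.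
have /cards2P[x [y [xy eA]]] : #|A| == 2%N.
  by case/andP: (hE A AE) A1; case: #|A| => [|[|[|]]].
move: uA AE; rewrite eA => /set2P[->|->] AE; first by exists y; rewrite ?inE.
by exists x; rewrite ?inE /adj finset.setUC.
Qed.

(** Double counting of incidences; a loop has a single endpoint, so equality can fail. *)
Lemma sum_deg : (\sum_(u : V) deg E u <= 2 * #|E|)%N.
Proof.
rewrite (eq_bigr (fun u => \sum_(A in E) if u \in A then 1 else 0)%N);
  last first.
  move=> u _; rewrite /deg -sum1_card big_mkcond /= [RHS]big_mkcond /=.
  by apply: eq_bigr => A _; rewrite inE; case: (A \in E); case: (u \in A).
rewrite exchange_big /= mulnC -sum_nat_const; apply: leq_sum => A AE.
by rewrite -big_mkcond sum1_card; case/andP: (hE A AE).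
Qed.

(** Ordered pairs are grouped by the edge they span; the double sum over all pairs in an edge is
    twice its [edge_diff]. *)
Lemma sum_adj_edge_diff (R : realType) (f : V -> R) :
  \sum_(i : V) \sum_(j | adj E i j) `|f i - f j|
  <= 2 * \sum_(A in E) edge_diff f A.
Proof.
rewrite pair_big_dep /= (partition_big (fun p => [set p.1; p.2]) (mem E)) //=.
rewrite mulr_sumr ler_sum // => A AE.
rewrite /edge_diff mulrC divfK ?pnatr_eq0 // pair_big /=.
rewrite big_mkcond [leRHS]big_mkcond /= ler_sum // => -[i j] _ /=.
case: (boolP ((i \in A) && (j \in A))) => ijA; first by case: ifP.
by case: ifP => // /andP[_ /eqP eA]; move: ijA; rewrite -eA set21 set22.
Qed.

End GraphCounting.

(** * Convergence of real series *)

Section RealSeries.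
Context (R : realType).

Lemma eseries_cvg (a : nat -> R) (l : R) :
  (series a @ \oo --> l)%classic -> (\sum_(0 <= t <oo) (a t)%:E)%E = l%:E.
Proof.
move=> al; rewrite -(cvg_lim (@Rhausdorff R) al) -EFin_lim; last exact: cvgP al.
by congr (limn _); apply/funext => n; rewrite sumEFin.
Qed.

Lemma series0 (a : nat -> R) : series a 0 = 0.
Proof. by rewrite /series /= big_geq. Qed.

(** The terms with index from [n / 2] to [n] are at least [a n], so [n * a n] is at most twice that
    block, which tends to 0. This removes the boundary term [t * survival t u] in the expected
    hitting time. *)
Lemma nonincreasing_summable_mulrn (a : nat -> R) :
  (forall n, 0 <= a n) -> {homo a : n m / (n <= m)%N >-> m <= n} ->
  cvgn (series a) -> (n%:R * a n @[n --> \oo] --> 0)%classic.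
Proof.
move=> a0 amono ca.
apply: (@squeeze_cvgr _ _ _ _ (fun=> 0)
  (fun n => 2 * (series a n - series a (n %/ 2)%N))).
- apply: nearW => n; rewrite mulr_ge0 //= sub_series_geq ?leq_div //.
  apply: (@le_trans _ _ (2 * \sum_(n %/ 2 <= k < n) a n)); last first.
    rewrite ler_pM2l// !big_nat ler_sum // => k /andP[_ kn].
    by apply: amono; exact: ltnW.
  rewrite sumr_const_nat -[X in _ <= 2 * X]mulr_natl mulrA ler_wpM2r //.
  by rewrite -natrM ler_nat; have := leq_divM n 2%N; rewrite mulnBr; lia.
- exact: cvg_cst.
- rewrite -[X in (_ --> X)%classic](mulr0 2).
  apply: cvgMl_tmp; rewrite -(subrr (limn (series a))).
  apply: cvgB; first exact: ca.
  apply: (@cvg_comp _ _ _ (fun n => (n %/ 2)%N) (series a) _ _ _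
    (@cvg_divnr 2 isT)).
  exact: ca.
Qed.

End RealSeries.

Section Walk.
Context (R : realType) (V : finType) (c : V -> V -> nat).
Hypothesis c0 : forall u, (0 < cvertex c u)%N.
Local Notation P := (trans R c).

Lemma trans_ge0 u w : 0 <= P u w.
Proof. by rewrite /trans divr_ge0. Qed.

Lemma sum_trans u : \sum_w P u w = 1.
Proof.
rewrite /trans -mulr_suml -natr_sum divff // pnatr_eq0 -lt0n; exact: c0.
Qed.

(** * First visits, survival probabilities and hitting times *)

Section HittingTime.
Context (v : V).
Local Notation f := (first_visit_pr R c).

Lemma first_visit_pr0 u : f u v 0 = (u == v)%:R.
Proof.
rewrite /first_visit_pr; case: eqVneq => [->|uv].
  rewrite (big_pred1 [tuple]) /= ?big_nil // => w.
  by rewrite (tuple0 w) /= !eqxx.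
by rewrite big_pred0 // => w; rewrite /= (negPf uv).
Qed.

Lemma first_visit_prS u t :
  f u v t.+1 = if u == v then 0 else \sum_w P u w * f w v t.
Proof.
rewrite /first_visit_pr; case: eqVneq => [->|uv].
  by rewrite big_pred0 // => w; rewrite /= eqxx.
(* First-step decomposition: a trajectory of length [t.+1] is its first vertex followed by one of
   length [t]. *)
rewrite (reindex (fun p : V * t.-tuple V => [tuple of p.1 :: p.2])) /=;
  last first.
  exists (fun w => (thead w, [tuple of behead w])) => [[x w] _|w _] /=.
    by congr pair; apply: val_inj.
  by rewrite [RHS]tuple_eta; apply: val_inj.
rewrite (negPf uv).
under [RHS]eq_bigr do rewrite mulr_sumr.
rewrite [RHS]pair_big_dep /=; apply: eq_big => [[x w]|[x w] _] //=.
by rewrite big_cons.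
Qed.

(* The probability that the walk from [u] has not visited [v] by time [t]. *)
Fixpoint survival (t : nat) (u : V) : R :=
  if u == v then 0 else if t is t'.+1 then \sum_w P u w * survival t' w else 1.

Lemma survival_target t : survival t v = 0.
Proof. by case: t => [|t] /=; rewrite eqxx. Qed.

Lemma survival_ge0 t u : 0 <= survival t u.
Proof.
elim: t u => [|t IH] u /=; case: eqP => // _.
by apply: sumr_ge0 => w _; rewrite mulr_ge0 ?trans_ge0.
Qed.

Lemma first_visit_pr_survival u t : f u v t.+1 = survival t u - survival t.+1 u.
Proof.
elim: t u => [|t IH] u; rewrite first_visit_prS /=; case: eqVneq => [_|uv];
  rewrite ?subr0 //.
  rewrite -[X in X - _](sum_trans u) -sumrB; apply: eq_bigr => w _.
  by rewrite first_visit_pr0; case: eqP; rewrite ?mulr1 ?mulr0 ?subr0 ?subrr.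
by rewrite -sumrB; apply: eq_bigr => w _; rewrite IH -mulrBr.
Qed.

Lemma first_visit_pr_ge0 u t : 0 <= f u v t.
Proof.
elim: t u => [|t IH] u; first by rewrite first_visit_pr0.
rewrite first_visit_prS; case: eqP => // _.
by apply: sumr_ge0 => w _; rewrite mulr_ge0 ?trans_ge0.
Qed.

Lemma survival_nonincreasing u :
  {homo survival^~ u : n m / (n <= m)%N >-> m <= n}.
Proof.
apply/nonincreasing_seqP => t.
by rewrite -subr_ge0 -first_visit_pr_survival first_visit_pr_ge0.
Qed.

Lemma series_first_visit_pr u t : series (f u v) t.+1 = 1 - survival t u.
Proof.
elim: t => [|t IH]; rewrite seriesSr.
  by rewrite series0 first_visit_pr0 add0r /=; case: eqP; rewrite ?subr0 ?subrr.
by rewrite IH first_visit_pr_survival; ring.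
Qed.

(** Summation by parts, since first visit probabilities are decrements of [survival]. *)
Lemma series_natr_first_visit_pr u t :
  series (fun t => t%:R * f u v t) t.+1
  = series (survival^~ u) t - t%:R * survival t u.
Proof.
elim: t => [|t IH]; rewrite seriesSr.
  by rewrite !series0 !mul0r subr0 addr0.
by rewrite IH seriesSr first_visit_pr_survival -natr1; ring.
Qed.

Lemma hitting_ge0 u : (0 <= hitting R c u v)%E.
Proof.
rewrite /hitting adde_ge0 //.
  by apply: nneseries_ge0 => t _ _;
    rewrite lee_fin mulr_ge0 ?first_visit_pr_ge0.
(* The mass of first visits by time [t] is [1 - survival t u], hence at most 1. *)
rewrite mule_ge0 // sube_ge0; last by rewrite orbT.
apply: lime_le.
  by apply: is_cvg_nneseries => t _ _; rewrite lee_fin first_visit_pr_ge0.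
apply: nearW => -[|t]; first by rewrite big_geq.
rewrite sumEFin lee_fin [leLHS]series_first_visit_pr.
by rewrite gerBl survival_ge0.
Qed.

Section Potential.
Context (g : V -> R).
Hypothesis g0 : g v = 0.
Hypothesis gP : forall u, u != v -> g u = 1 + \sum_w P u w * g w.

(* [g] is the [survival] series truncated at [t] plus the expectation of
   [g (X_t)] on the event that [v] has not been visited by time [t]. *)
Lemma potential_survival u t :
  `|g u - series (survival^~ u) t| <= (\sum_w `|g w|) * survival t u.
Proof.
have at_v n : `|g v - series (survival^~ v) n|
    <= (\sum_w `|g w|) * survival n v.
  rewrite survival_target /series /= big1 ?g0 ?subrr ?normr0 ?mulr0 // => k _.
  exact: survival_target.
elim: t u => [|t IH] u; have [->|uv] := eqVneq u v; [exact: at_v|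
  |exact: at_v|].
  rewrite series0 subr0 /= (negPf uv) mulr1 (bigD1 u) //=.
  by rewrite lerDl sumr_ge0.
(* Both [g] and the truncated survival series satisfy the one-step equation off [v], so their
   difference is averaged by [P]. *)
have -> : g u - series (survival^~ u) t.+1
    = \sum_w P u w * (g w - series (survival^~ w) t).
  under [RHS]eq_bigr do rewrite mulrBr.
  rewrite sumrB gP // /series /= big_nat_recl //= (negPf uv).
  rewrite [X in _ - (_ + X)](_ : _ =
    \sum_w P u w * \sum_(0 <= k < t) survival k w); first by ring.
  under [RHS]eq_bigr do rewrite mulr_sumr.
  by rewrite exchange_big.
rewrite /= (negPf uv) mulr_sumr (le_trans (ler_norm_sum _ _ _)) //.
rewrite ler_sum // => w _.
by rewrite normrM ger0_norm ?trans_ge0 // mulrCA ler_wpM2l ?trans_ge0.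
Qed.

(** [potential_survival] bounds the partial sums, so [survival] is summable and tends to 0; the same
    estimate then identifies the sum as [g u]. Monotonicity gives the limit of
    [t * survival t u]. *)
Lemma cvg_series_survival u : (series (survival^~ u) @ \oo --> g u)%classic
  /\ (t%:R * survival t u @[t --> \oo] --> 0)%classic
  /\ (survival t u @[t --> \oo] --> 0)%classic.
Proof.
set M := \sum_w `|g w|.
have M0 : 0 <= M by rewrite sumr_ge0.
have S1 t : survival t u <= 1.
  apply: (@le_trans _ _ (survival 0 u)); first exact: survival_nonincreasing.
  by rewrite /=; case: eqP.
have cS : cvgn (series (survival^~ u)).
  apply: nondecreasing_is_cvgn.
    by apply: nondecreasing_series => n _ _; exact: survival_ge0.
  exists (g u + M) => _ [t _ <-].
  have := potential_survival u t; rewrite ler_distlC => /andP[_ /le_trans]; apply.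
  by rewrite lerD2l ler_piMr.
have S0 := cvg_series_cvg_0 cS.
split; last first.
  split=> //; apply: nonincreasing_summable_mulrn => //.
    by move=> n; exact: survival_ge0.
  exact: survival_nonincreasing.
apply/subr_cvg0; apply: norm_cvg0.
apply: (@squeeze_cvgr _ _ _ _ (fun=> 0) (fun t => M * survival t u)).
- by apply: nearW => t; rewrite normr_ge0 distrC potential_survival.
- exact: cvg_cst.
- by rewrite -[X in (_ --> X)%classic](mulr0 M); exact: cvgMl_tmp.
Qed.

(** Summation by parts turns the expectation into the sum of [survival], which is [g u]; the mass of
    first visits is 1, so the infinite summand is [+oo * 0 = 0]. *)
Lemma hitting_potential u : hitting R c u v = (g u)%:E.
Proof.
have [Sg [tS S0]] := cvg_series_survival u.
have Tg : (series (fun t => t%:R * f u v t) @ \oo --> g u)%classic.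
  rewrite -cvg_shiftS -[g u]subr0.
  rewrite (_ : mk_sequence _ =
    series (survival^~ u) - (fun t => t%:R * survival t u)).
    exact: cvgB.
  by apply/funext => t; exact: series_natr_first_visit_pr.
have F1 : (series (f u v) @ \oo --> (1 : R))%classic.
  rewrite -cvg_shiftS -[X in ball_ _ X]subr0.
  rewrite (_ : mk_sequence _ = (fun=> 1) - (survival^~ u)).
    by apply: cvgB => //; exact: cvg_cst.
  by apply/funext => t; exact: series_first_visit_pr.
rewrite /hitting (eseries_cvg _ _ _ Tg) (eseries_cvg _ _ _ F1).
by rewrite subee // mule0 adde0.
Qed.

End Potential.
End HittingTime.

(** * Transition probabilities to [v] and the Poisson equation *)

Section Transition.
Context (v : V).
Hypothesis csym : forall u w, c u w = c w u.
Local Notation x := (fun t u => transX R c t u v).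
Local Notation p := (stationary R c v).

Lemma transX0 u : transX R c 0 u v = (u == v)%:R.
Proof. by rewrite /transX expr0 mxE (inj_eq enum_rank_inj). Qed.

Lemma transXS t u : transX R c t.+1 u v = \sum_w P u w * transX R c t w v.
Proof.
rewrite /transX exprS -mulmxE mxE (reindex_onto enum_rank enum_val) /=;
  last first.
  by move=> a _; rewrite enum_valK.
by apply: eq_big => [w|w _]; rewrite ?mxE !enum_rankK ?eqxx.
Qed.

(** The vertex weights are an invariant measure: by symmetry [c u w], summed over [u], gives
    [cvertex c w]. *)
Lemma sum_cvertex_transX t :
  \sum_u (cvertex c u)%:R * transX R c t u v = (cvertex c v)%:R.
Proof.
elim: t => [|t IH].
  rewrite (bigD1 v) //= transX0 eqxx mulr1 big1 ?addr0 // => u uv.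
  by rewrite transX0 (negPf uv) mulr0.
rewrite -[RHS]IH; under eq_bigr do rewrite transXS mulr_sumr.
rewrite exchange_big /=; apply: eq_bigr => w _.
rewrite [in RHS]/cvertex natr_sum mulr_suml; apply: eq_bigr => u _.
by rewrite mulrA /trans mulrCA divff ?mulr1 1?csym // pnatr_eq0 -lt0n.
Qed.

Lemma sum_cvertex_gt0 : 0 < (\sum_u cvertex c u)%N%:R :> R.
Proof. by rewrite ltr0n (bigD1 v) //= addn_gt0 c0. Qed.

Lemma stationary_gt0 : 0 < p.
Proof. by rewrite /stationary divr_gt0 ?sum_cvertex_gt0 // ltr0n. Qed.

Section Summable.
Hypothesis cvgx : forall u, cvgn (series (fun t => x t u - x t v)).
Let D u := limn (series (fun t => x t u - x t v)).

Let cvg_D u : (series (fun t => x t u - x t v) @ \oo --> D u)%classic.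
Proof. exact: cvgx. Qed.

(** The differences [x t w - x t v] tend to 0, being terms of convergent series, while the
    stationary average of [x t] is always [p]. *)
Lemma transX_cvg u : (x t u @[t --> \oo] --> p)%classic.
Proof.
have x0 w : (x t w - x t v @[t --> \oo] --> (0 : R))%classic.
  exact: cvg_series_cvg_0.
suff xv : (x t v @[t --> \oo] --> p)%classic.
  rewrite (_ : (fun t => _) = (fun t => x t u - x t v) + x^~ v).
    by rewrite -[p]add0r; exact: cvgD.
  by apply/funext => t; rewrite /= [RHS]subrK.
set C : R := (\sum_u cvertex c u)%N%:R.
have C0 : C != 0 by rewrite gt_eqF // sum_cvertex_gt0.
(* The invariance identity solved for [x t v], leaving only differences that vanish in the limit. *)
rewrite (_ : (fun t => _) = (fun t => ((cvertex c v)%:R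
    - \sum_w (cvertex c w)%:R * (x t w - x t v)) / C)); last first.
  apply/funext => t; apply: (mulIf C0); rewrite divfK //.
  under eq_bigr do rewrite mulrBr.
  rewrite sumrB sum_cvertex_transX -mulr_suml -natr_sum -/C; ring.
apply: cvgMr_tmp; rewrite -[X in (_ --> X)%classic]subr0.
apply: cvgB; first exact: cvg_cst.
rewrite [X in (_ --> X)%classic](_ : 0 = \sum_w (cvertex c w)%:R * 0).
  by apply: cvg_big => [|w _]; [exact: add_continuous|exact: cvgMl_tmp].
by rewrite big1 // => w _; rewrite mulr0.
Qed.

(* [D] is a potential with source at [v]: telescoping gives
   [P D_T - D_T = x_T - x_0] for the partial sums [D_T], and [x_T] tends to the
   stationary probability of [v]. *)
Lemma poisson u : \sum_w P u w * D w - D u = p - (u == v)%:R.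
Proof.
have H T : \sum_w P u w * series (fun t => x t w - x t v) T
    - series (fun t => x t u - x t v) T = x T u - (u == v)%:R.
  elim: T => [|T IH].
    by rewrite series0 transX0 !subrr big1 ?subrr // => w _;
      rewrite series0 mulr0.
  rewrite seriesSr; under eq_bigr do rewrite seriesSr mulrDr mulrBr.
  rewrite big_split /= sumrB -transXS -mulr_suml sum_trans mul1r.
  move: IH => /eqP; rewrite subr_eq => /eqP ->; ring.
have lim1 : (x T u - (u == v)%:R @[T --> \oo] --> p - (u == v)%:R)%classic.
  by apply: cvgB; [exact: transX_cvg|exact: cvg_cst].
have lim2 : (x T u - (u == v)%:R @[T --> \oo]
    --> \sum_w P u w * D w - D u)%classic.
  under eq_cvg do rewrite -H.
  apply: cvgB; last exact: cvg_D.
  apply: cvg_big => [|w _]; first exact: add_continuous.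
  by apply: cvgMl_tmp; exact: cvg_D.
exact: (cvg_unique (@Rhausdorff R) lim2 lim1).
Qed.

Lemma hitting_sum_transX u : hitting R c u v = (- D u / p)%:E.
Proof.
have p0 : p != 0 by rewrite gt_eqF // stationary_gt0.
apply: (hitting_potential v (fun u => - D u / p)) => [|w wv].
  rewrite /D (_ : (fun t => _) = fun=> 0); last first.
    by apply/funext => t; rewrite subrr.
  rewrite (_ : series _ = fun=> 0); last first.
    by apply/funext => T; rewrite /series /= big1.
  by rewrite lim_cst // oppr0 mul0r.
have := poisson w; rewrite (negPf wv) subr0 => /eqP; rewrite subr_eq => /eqP Dw.
under eq_bigr do rewrite mulrA mulrN.
rewrite -mulr_suml sumrN Dw; field.
by [].
Qed.

End Summable.
End Transition.
End Walk.

(** * Scaling, triangle inequality and continuity of edge differences *)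

Section EdgeDiff.
Context (R : realType) (V : finType).
Implicit Types (f : V -> R) (A : {set V}).

Lemma edge_diff_ge0 f A : 0 <= edge_diff f A.
Proof. by rewrite divr_ge0 // sumr_ge0 // => i _; rewrite sumr_ge0. Qed.

Lemma edge_diff_affine (a b : R) f A :
  edge_diff (fun u => a * f u + b) A = `|a| * edge_diff f A.
Proof.
rewrite /edge_diff mulrA mulr_sumr; congr (_ / _); apply: eq_bigr => i _.
rewrite mulr_sumr; apply: eq_bigr => j _.
by rewrite -normrM; congr (`|_|); ring.
Qed.

Lemma edge_diff_sum (r : seq nat) (F : nat -> V -> R) A :
  edge_diff (fun u => \sum_(t <- r) F t u) A <= \sum_(t <- r) edge_diff (F t) A.
Proof.
rewrite /edge_diff -mulr_suml ler_pM2r ?invr_gt0 // [leRHS]exchange_big /=.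
rewrite ler_sum //= => i _.
rewrite [leRHS]exchange_big ler_sum //= => j _.
by rewrite -sumrB; exact: ler_norm_sum.
Qed.

Lemma cvg_edge_diff (F : nat -> V -> R) f A :
  (forall u, (F T u @[T --> \oo] --> f u)%classic) ->
  (edge_diff (F T) A @[T --> \oo] --> edge_diff f A)%classic.
Proof.
move=> Ff; rewrite /edge_diff; apply: cvgMr_tmp.
apply: cvg_big => [|i _]; first exact: add_continuous.
apply: cvg_big => [|j _]; first exact: add_continuous.
by apply: cvg_norm; exact: cvgB.
Qed.

End EdgeDiff.

(** * Hitting time differences bounded by the local divergence *)

Section LocalDivergence.
Context (R : realType) (V : finType) (E : {set {set V}}) (c : V -> V -> nat).
Hypothesis hconn : connected_graph E.
Hypothesis csym : forall u w, c u w = c w u.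
Hypothesis c0 : forall u, (0 < cvertex c u)%N.
Context (v : V).
Local Notation x := (fun t u => transX R c t u v).
Local Notation total t :=
  (\sum_(A in E) edge_diff (fun u => transX R c t u v) A).

Let total_ge0 t : 0 <= total t.
Proof. by rewrite sumr_ge0 // => A _; exact: edge_diff_ge0. Qed.

Lemma local_divergence_ge0 : (0 <= local_divergence R E c v)%E.
Proof. by apply: nneseries_ge0 => t _ _; rewrite lee_fin. Qed.

Hypothesis fin_div : (local_divergence R E c v < +oo)%E.

Lemma cvg_series_transX_sub u w : cvgn (series (fun t => x t u - x t w)).
Proof.
have total_cvg : cvgn (series (fun t => total t)) by apply: nnseries_is_cvg.
have edge_cvg i j : adj E i j -> cvgn (series (fun t => x t i - x t j)).
  move=> ij; apply: normed_cvg.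
  apply: (series_le_cvg _ _ _ total_cvg) => // t; first exact: normr_ge0.
  have /= <- := edge_diffE (fun u => transX R c t u v) i j.
  rewrite (bigD1 [set i; j]) //=.
  by rewrite lerDl sumr_ge0 // => A _; exact: edge_diff_ge0.
(* Along a path the difference between the ends is the sum of the differences over its edges. *)
have /connectP[s] := hconn u w; elim: s u => [|i s IH] u /=.
  move=> _ ->; rewrite (_ : (fun t => _) = fun=> 0).
    rewrite (_ : series _ = fun=> 0); first exact: is_cvg_cst.
    by apply/funext => T; rewrite /series /= big1.
  by apply/funext => t; rewrite subrr.
move=> /andP[ui si] wE.
rewrite (_ : (fun t => _) =
    (fun t => x t u - x t i) + (fun t => x t i - x t w)).
  by apply: is_cvg_seriesD; [exact: edge_cvg|exact: IH].
by apply/funext => t; rewrite /= [RHS]addrA subrK.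
Qed.

(** The witness [g] is the potential [- D / p]; it records that hitting times are finite, so that
    later estimates take place in [R]. *)
Lemma hitting_local_divergence : exists g : V -> R,
  (forall u, hitting R c u v = (g u)%:E) /\
  ((\sum_(A in E) edge_diff g A)%:E
     <= (stationary R c v)^-1%:E * local_divergence R E c v)%E.
Proof.
pose D u := limn (series (fun t => x t u - x t v)).
have p0 := stationary_gt0 R V c c0 v.
exists (fun u => - D u / stationary R c v); split=> [u|].
  by apply: hitting_sum_transX => // w; exact: cvg_series_transX_sub.
(* Edge differences ignore the sign of [- D / p] and scale by [1 / p]. *)
rewrite (eq_bigr (fun A => (stationary R c v)^-1 * edge_diff D A)); last first.
  move=> A _; rewrite -[in RHS](ger0_norm (ltW p0)) -normfV -normrN.
  rewrite -(edge_diff_affine _ _ _ 0); congr (edge_diff _ _).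
  by apply/funext => u; rewrite addr0 mulrC mulNr mulrN.
rewrite -mulr_sumr EFinM lee_wpmul2l ?lee_fin ?invr_ge0 ?(ltW p0) //.
have fin : local_divergence R E c v \is a fin_num.
  by rewrite ge0_fin_numE // local_divergence_ge0.
rewrite -(fineK fin) lee_fin.
have lim1 : (\sum_(A in E)
    edge_diff (fun u => series (fun t => x t u - x t v) T) A
    @[T --> \oo] --> \sum_(A in E) edge_diff D A)%classic.
  apply: cvg_big => [|A _]; first exact: add_continuous.
  by apply: cvg_edge_diff => u; exact: cvg_series_transX_sub.
rewrite -(cvg_lim (@Rhausdorff R) lim1); apply: limr_le; first exact: cvgP lim1.
apply: nearW => T; rewrite -lee_fin (fineK fin).
apply: le_trans (nneseries_lim_ge T _); last by move=> t _ _; rewrite lee_fin.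
rewrite sumEFin lee_fin [leRHS]exchange_big ler_sum //= => A _.
rewrite (le_trans (edge_diff_sum _ _ _ _ _)) // ler_sum // => t _.
(* The constant [x t v] cancels in every edge difference. *)
rewrite -[leRHS]mul1r -[X in X * _]normr1 -(edge_diff_affine _ _ _ (- x t v)).
rewrite le_eqVlt; apply/orP; left; apply/eqP; congr (edge_diff _ _).
by apply/funext => u; rewrite mul1r.
Qed.

End LocalDivergence.

(** * Rotor lengths against [kappa] and [cmax] *)

Section Rotor.
Context (R : realType) (V : finType) (E : {set {set V}}) (c : V -> V -> nat).
Context (d : V -> nat) (s : forall u : V, (d u).-tuple V).
Hypothesis hE : is_edge_set E.
Hypothesis hc : is_weight E c.
Hypothesis hs : is_rotor R c s.

(** At total weight 0 division by zero would make all of [trans c u] zero, yet some vertex occurs in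
    the nonempty rotor sequence. *)
Lemma rotor_cvertex_gt0 u : (0 < cvertex c u)%N.
Proof.
have [d0 sP] := hs u; rewrite lt0n; apply/eqP => cu0.
have [w ws] : exists w, w \in tval (s u).
  case: (tval (s u)) (size_tuple (s u)) d0 => [<-//|w ? _ _].
  by exists w; rewrite mem_head.
have := sP w; rewrite /trans cu0 invr0 mulr0 => /eqP.
by rewrite mulf_eq0 invr_eq0 !pnatr_eq0 -leqn0 leqNgt -has_count has_pred1 ws
  eqn0Ngt d0.
Qed.

Lemma weight_le_cmax u w : (c u w <= cmax c)%N.
Proof. by apply: leq_trans (leq_bigmax u); apply: (leq_bigmax w). Qed.

Lemma weight_adj u w : (c u w <= cmax c * adj E u w)%N.
Proof.
rewrite -(proj2 hc); case: (posnP (c u w)) => [->//|_].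
by rewrite muln1 weight_le_cmax.
Qed.

Lemma deg_sum_adj u : deg E u = (\sum_w adj E u w)%N.
Proof.
rewrite deg_adj // -sum1_card big_mkcond /=; apply: eq_bigr => w _.
by rewrite inE; case: adj.
Qed.

(** Weights are integers, hence at least 1 on each edge. *)
Lemma deg_le_cvertex u : (deg E u <= cvertex c u)%N.
Proof.
rewrite deg_sum_adj; apply: leq_sum => w _.
by rewrite -(proj2 hc); case: (c u w).
Qed.

Lemma cvertex_le_deg u : (cvertex c u <= cmax c * deg E u)%N.
Proof.
rewrite deg_sum_adj big_distrr /=; apply: leq_sum => w _; exact: weight_adj.
Qed.

Lemma deg_gt0 u : (0 < deg E u)%N.
Proof.
have := leq_trans (rotor_cvertex_gt0 u) (cvertex_le_deg u).
by rewrite muln_gt0 => /andP[].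
Qed.

Lemma cmax_gt0 (u : V) : (0 < cmax c)%N.
Proof.
have := leq_trans (rotor_cvertex_gt0 u) (cvertex_le_deg u).
by rewrite muln_gt0 => /andP[].
Qed.

Lemma rotor_le_kappa u : (d u)%:R <= kappa R E d * (deg E u)%:R.
Proof.
rewrite -ler_pdivrMr ?ltr0n ?deg_gt0 //.
exact: (le_bigmax 0 (fun u => (d u)%:R / (deg E u)%:R)).
Qed.

Lemma kappa_gt0 (u : V) : 0 < kappa R E d.
Proof.
have := rotor_le_kappa u; rewrite leNgt; apply: contraR; rewrite -leNgt => k0.
rewrite (@le_lt_trans _ _ 0) ?mulr_le0_ge0 // ltr0n; exact: (hs u).1.
Qed.

(** From [d i <= kappa * deg i <= kappa * cvertex c i] the denominator of [trans] cancels, leaving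
    the weight of one edge. *)
Lemma rotor_trans_le i j :
  (d i)%:R * trans R c i j <= kappa R E d * (cmax c)%:R * (adj E i j)%:R.
Proof.
have ci : 0 < (cvertex c i)%:R :> R by rewrite ltr0n rotor_cvertex_gt0.
have k0 := ltW (kappa_gt0 i).
rewrite /trans mulrA ler_pdivrMr //.
apply: (@le_trans _ _
    (kappa R E d * (cvertex c i)%:R * ((cmax c)%:R * (adj E i j)%:R))).
  rewrite ler_pM //.
    apply: le_trans (rotor_le_kappa i) _.
    by rewrite ler_wpM2l // ler_nat deg_le_cvertex.
  by rewrite -natrM ler_nat weight_adj.
by rewrite le_eqVlt; apply/orP; left; apply/eqP; ring.
Qed.

(** The same cancellation of [cvertex c v] leaves [kappa] times the total weight, which is at most
    [cmax] times the degree sum. *)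
Lemma rotor_stationary_le v :
  (d v)%:R / stationary R c v <= 2 * #|E|%:R * kappa R E d * (cmax c)%:R.
Proof.
have cv : 0 < (cvertex c v)%:R :> R by rewrite ltr0n rotor_cvertex_gt0.
have k0 := ltW (kappa_gt0 v).
rewrite /stationary invf_div mulrA ler_pdivrMr //.
apply: (@le_trans _ _
    (kappa R E d * (cvertex c v)%:R * (2 * #|E|%:R * (cmax c)%:R))).
  rewrite ler_pM //.
    apply: le_trans (rotor_le_kappa v) _.
    by rewrite ler_wpM2l // ler_nat deg_le_cvertex.
  rewrite -!natrM ler_nat mulnC.
  apply: leq_trans (leq_mul (leqnn _) (sum_deg V E hE)).
  rewrite big_distrr /=; apply: leq_sum => u _; exact: cvertex_le_deg.
by rewrite le_eqVlt; apply/orP; left; apply/eqP; ring.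
Qed.

(** Each pair costs at most [|g i - g j| + 1]: the first parts count every edge at most twice, the
    ones add up to the degree sum. *)
Lemma sum_rotor_trans_le (g : V -> R) :
  \sum_i \sum_j (d i)%:R * trans R c i j * `|g i - g j - 1|
  <= kappa R E d * (cmax c)%:R
     * (2 * \sum_(A in E) edge_diff g A + 2 * #|E|%:R).
Proof.
have k0 : 0 <= kappa R E d * (cmax c)%:R by rewrite mulr_ge0 // bigmax_ge_id.
apply: (@le_trans _ _ (\sum_i \sum_j
    kappa R E d * (cmax c)%:R * ((adj E i j)%:R * (`|g i - g j| + 1)))).
  apply: ler_sum => i _; apply: ler_sum => j _; rewrite [leRHS]mulrA.
  apply: ler_pM => //.
  - by rewrite mulr_ge0 // trans_ge0.
  - exact: rotor_trans_le.
  - by rewrite (le_trans (ler_normB _ _)) // normr1.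
under eq_bigr do rewrite -mulr_sumr.
rewrite -mulr_sumr ler_wpM2l //.
apply: le_trans (lerD (sum_adj_edge_diff V E R g)
  (_ : (\sum_u deg E u)%:R <= _)); last first.
  by rewrite -natrM ler_nat sum_deg.
rewrite natr_sum -big_split /= ler_sum // => i _.
rewrite deg_sum_adj natr_sum [X in _ <= X + _]big_mkcond -big_split /=.
rewrite ler_sum // => j _.
by case: adj; rewrite ?mul1r ?mul0r ?addr0.
Qed.

End Rotor.

Theorem theorem3p5 (R : realType) (V : finType) (E : {set {set V}})
    (hE : is_edge_set E) (hconn : connected_graph E)
    (c : V -> V -> nat) (hc : is_weight E c)
    (d : V -> nat) (s : forall u : V, (d u).-tuple V)
    (hs : is_rotor R c s) (v : V) :
  (Kconst R c d v <=
     max_hitting R c v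
     + (kappa R E d * (cmax c)%:R / stationary R c v)%:E * local_divergence R E c v
     + (2 * #|E|%:R * kappa R E d * (cmax c)%:R)%:E)%E.
Proof.
have c0 := rotor_cvertex_gt0 R V c d s hs.
have p0 := stationary_gt0 R V c c0 v.
have k0 := kappa_gt0 R V E c d s hE hc hs v.
have m0 : 0 < (cmax c)%:R :> R
  by rewrite ltr0n (cmax_gt0 R V E c d s hE hc hs v).
have [div_fin|] := ltP (local_divergence R E c v) +oo%E; last first.
  rewrite leye_eq => /eqP ->.
  rewrite gt0_muley ?lte_fin; last by rewrite divr_gt0 // mulr_gt0.
  rewrite addey ?addye ?leey //.
  (* The sum is [+oo] once [max_hitting] is not [-oo], and it dominates a nonnegative hitting
     time. *)
  apply: contraTneq (hitting_ge0 R V c c0 v v) => mh; rewrite -ltNge.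
  apply: (@le_lt_trans _ _ -oo%E); last exact: ltNyr.
  rewrite -mh.
  exact: (le_bigmax -oo%E (fun u => hitting R c u v)).
have [g [hg gdiv]] :=
  hitting_local_divergence R V E c hconn (proj1 hc) c0 v div_fin.
rewrite /Kconst -addeA leeD2l //.
under eq_bigr do under eq_bigr do rewrite !hg -!EFinB -EFinM.
under eq_bigr do rewrite sumEFin.
rewrite sumEFin -EFinD -EFinM.
apply: (@le_trans _ _ ((kappa R E d * (cmax c)%:R)%:E
  * (\sum_(A in E) edge_diff g A)%:E
  + (2 * #|E|%:R * kappa R E d * (cmax c)%:R)%:E)%E); last first.
  apply: leeD2r; rewrite (EFinM _ (stationary R c v)^-1) -muleA lee_wpmul2l //.
  by rewrite lee_fin mulr_ge0 // ltW.
rewrite -EFinM -EFinD lee_fin.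
have := rotor_stationary_le R V E c d s hE hc hs v.
have := sum_rotor_trans_le R V E c d s hE hc hs g.
(* With [S] the sum of edge differences and [k = kappa * cmax], half of [2 m k + k (2 S + 2 m)] is
   [k S + 2 m k]. *)
lra.
Qed.
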